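(* A ring $R$ is a strong UII-ring if and only if $R$ is one of the following types: (1) $U(R)=\{1\}$. (2) $U(R)=1+{\rm idem}(R)$. (3) $R=A\oplus B$ (a direct sum of rings), where $U(A)=\{1\}$ and $U(B)=1+{\rm idem}(B)$.
   Context: Rings are associative with identity, not necessarily commutative. $U(R)$ is the unit group of $R$ and ${\rm idem}(R)$ is the set of idempotents of $R$; $1+{\rm idem}(R)=\{1+e: e\in{\rm idem}(R)\}$. $R$ is a strong UII-ring if every unit of $R$ is a sum of two commuting idempotents of $R$. *)

(* Defs.v *)
From HB Require Import structures.
From mathcomp Require Import all_boot all_order all_algebra.
From mathcomp Require Import classical_sets.

Import GRing.Theory.

Local Open Scope ring_scope.
Local Open Scope classical_set_scope.

(* Rings are [pzRingType]s: associative, with identity, possibly zero.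
   [GRing.unit] is not used because it needs a [unitRingType], i.e. a nonzero
   ring with a chosen inverse and a boolean test for invertibility. *)
Definition units (R : pzRingType) : set R :=
  [set u | exists v : R, u * v = 1 /\ v * u = 1].

Definition idem (R : pzRingType) : set R := [set e | e * e = e].

Definition one_plus_idem (R : pzRingType) : set R :=
  [set 1 + e | e in idem R].

Definition strong_UII (R : pzRingType) : Prop :=
  forall u : R, units R u ->
    exists e f : R,
      [/\ idem R e, idem R f, GRing.comm e f & u = e + f].

(* The ring [A * B] has componentwise operations and identity [(1, 1)], and
   an [{rmorphism _ -> _}] preserves 1. *)
Definition is_direct_sum (R A B : pzRingType) : Prop :=
  exists phi : {rmorphism R -> (A * B)%type}, bijective phi.

(* Main.v *)
Require Import Defs.
From HB Require Import structures.
From mathcomp Require Import all_boot all_order all_algebra.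
From mathcomp Require Import classical_sets.

Import GRing.Theory.

Local Open Scope ring_scope.
Local Open Scope classical_set_scope.

(** Writing [-1 = e + f] with commuting idempotents [e], [f] forces [6 = 0],
    so the central idempotents [3] and [1 - 3] split [R] as [A * B] with [2 = 0]
    in [A] and [3 = 0] in [B], and both factors are again strong UII-rings.
    In [A] every unit [e + f] is idempotent, hence equals [1].
    In [B] every unit [u = e + f] satisfies [u^3 = u], so [u^2 = 1], which in
    characteristic 3 says that [u - 1] is idempotent. The zero ring satisfies
    both conditions on units, so the third type subsumes the other two. *)

(** * The ring cut out by a central idempotent *)

Section Corner.

Context {R : pzRingType} {c : R}.

(** For idempotent [c] these are exactly the multiples [c * x]; the fixed-point form is a decidable
    equation. *)
Definition in_corner : pred R := [pred x | c * x == x].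

Lemma in_corner_zmod_closed : zmod_closed in_corner.
Proof.
split=> [|x y]; rewrite !inE ?mulr0 //.
by move=> /eqP cx /eqP cy; rewrite mulrBr cx cy.
Qed.

HB.instance Definition _ :=
  GRing.isZmodClosed.Build R in_corner in_corner_zmod_closed.

Hypotheses (c_central : forall x, GRing.comm c x) (c_idem : idem R c).

(* The ring [c R] with identity [c]; the proofs are parameters of the type so
   that its ring structure can be inferred. *)
Definition corner of (forall x, GRing.comm c x) & idem R c : Type :=
  {x : R | in_corner x}.

Local Notation S := (corner c_central c_idem).

HB.instance Definition _ := SubChoice.on S.
HB.instance Definition _ := [SubChoice_isSubZmodule of S by <:].

Lemma in_corner_mull x : in_corner (c * x).
Proof. by rewrite /in_corner /= mulrA (c_idem : c * c = c). Qed.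

Definition to_corner x : S := Sub (c * x) (in_corner_mull x).

Lemma val_to_corner x : val (to_corner x) = c * x.
Proof. exact: SubK. Qed.

Lemma corner_mull (x : S) : c * val x = val x.
Proof. exact/eqP/(valP x). Qed.

Lemma corner_mulr (x : S) : val x * c = val x.
Proof. by rewrite -c_central corner_mull. Qed.

Lemma val_cornerD (x y : S) : val (x + y) = val x + val y.
Proof. exact: raddfD. Qed.

Lemma val_cornerB (x y : S) : val (x - y) = val x - val y.
Proof. exact: raddfB. Qed.

Definition corner_mul (x y : S) : S := to_corner (val x * val y).

Lemma val_corner_mul x y : val (corner_mul x y) = val x * val y.
Proof. by rewrite val_to_corner mulrA corner_mull. Qed.

Lemma val_corner_one : val (to_corner 1) = c.
Proof. by rewrite val_to_corner mulr1. Qed.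

Lemma corner_mulA : associative corner_mul.
Proof. by move=> x y z; apply: val_inj; rewrite !val_corner_mul mulrA. Qed.

Lemma corner_mul1l : left_id (to_corner 1) corner_mul.
Proof.
by move=> x; apply: val_inj; rewrite val_corner_mul val_corner_one corner_mull.
Qed.

Lemma corner_mul1r : right_id (to_corner 1) corner_mul.
Proof.
by move=> x; apply: val_inj; rewrite val_corner_mul val_corner_one corner_mulr.
Qed.

Lemma corner_mulDl : left_distributive corner_mul +%R.
Proof.
move=> x y z; apply: val_inj.
by rewrite val_cornerD !val_corner_mul val_cornerD mulrDl.
Qed.

Lemma corner_mulDr : right_distributive corner_mul +%R.
Proof.
move=> x y z; apply: val_inj.
by rewrite val_cornerD !val_corner_mul val_cornerD mulrDr.
Qed.

HB.instance Definition _ := GRing.Zmodule_isPzRing.Build S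
  corner_mulA corner_mul1l corner_mul1r corner_mulDl corner_mulDr.

Lemma to_corner_is_zmod_morphism : zmod_morphism to_corner.
Proof.
by move=> x y; apply: val_inj; rewrite val_cornerB !val_to_corner mulrBr.
Qed.

Lemma to_corner_is_monoid_morphism : monoid_morphism to_corner.
Proof.
split=> // x y; apply: val_inj; rewrite val_corner_mul !val_to_corner.
by rewrite -mulrA [x * (c * y)]mulrA -(c_central x) !mulrA (c_idem : c * c = c).
Qed.

HB.instance Definition _ :=
  GRing.isZmodMorphism.Build R S to_corner to_corner_is_zmod_morphism.
HB.instance Definition _ :=
  GRing.isMonoidMorphism.Build R S to_corner to_corner_is_monoid_morphism.

(** Reads off the characteristic of the corner inside [R]: the identity of [S] has underlying value
    [c]. *)
Lemma corner_natr_eq0 n : c *+ n = 0 -> n%:R = 0 :> S.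
Proof.
move=> cn0; rewrite -(rmorph_nat to_corner); apply: val_inj.
by rewrite val_to_corner raddf0 mulr_natr cn0.
Qed.

End Corner.

(** * Splitting along a central idempotent, and units in direct sums *)

Section DirectSum.

Context {R A B : pzRingType}.

Lemma commB1 (c : R) :
  (forall x, GRing.comm c x) -> forall x, GRing.comm (1 - c) x.
Proof. by move=> cC x; apply/commr_sym/commrB; [exact: commr1 | exact/commr_sym]. Qed.

Lemma idemB1 (c : R) : idem R c -> idem R (1 - c).
Proof.
move=> cI; rewrite /idem /= mulrBr mulr1 mulrBl mul1r.
by rewrite (cI : c * c = c) subrr subr0.
Qed.

Lemma direct_sum_corners (c : R)
    (cC : forall x, GRing.comm c x) (cI : idem R c) :
  is_direct_sum R (corner cC cI) (corner (commB1 c cC) (idemB1 c cI)).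
Proof.
pose phi x := (to_corner cC cI x, to_corner (commB1 c cC) (idemB1 c cI) x).
have phiB : zmod_morphism phi by move=> x y; rewrite /phi !raddfB.
have phiM : monoid_morphism phi.
  by split=> [|x y]; rewrite /phi ?rmorph1 ?rmorphM.
pose phiBM := GRing.isZmodMorphism.Build _ _ phi phiB.
pose phiMM := GRing.isMonoidMorphism.Build _ _ phi phiM.
pose phiR : {rmorphism R -> _} := HB.pack phi phiBM phiMM.
(* The inverse adds the two components, as [x = c * x + (1 - c) * x]. *)
exists phiR; exists (fun p => val p.1 + val p.2) => [x|[a b]] /=.
  by rewrite mulrBl mul1r addrC subrK.
have ca := corner_mull _ _ a.
have cb0 : c * val b = 0.
  rewrite -(corner_mull _ _ b) mulrA mulrBr mulr1 (cI : c * c = c).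
  by rewrite subrr mul0r.
congr (_, _); apply: val_inj; rewrite val_to_corner mulrDr ?mulrBl ?mul1r.
  by rewrite ca cb0 addr0.
by rewrite ca cb0 subrr subr0 add0r.
Qed.

(** A unit of one factor is padded with [1] in the other, decomposed in the product, and projected
    back. *)
Lemma strong_UII_direct_sum :
  is_direct_sum R A B -> strong_UII R -> strong_UII A /\ strong_UII B.
Proof.
move=> [phi [psi phiK psiK]] UR.
have UAB p q : p * q = 1 -> q * p = 1 -> exists e f,
    [/\ idem _ e, idem _ f, GRing.comm e f & p = e + f :> A * B].
  move=> pq qp; have [|e [f [eI fI ef pE]]] := UR (psi p).
    exists (psi q).
    by split; apply: (can_inj phiK); rewrite rmorphM !psiK rmorph1.
  exists (phi e), (phi f); split; first by rewrite /idem /= -rmorphM eI.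
  - by rewrite /idem /= -rmorphM fI.
  - by rewrite /GRing.comm -!rmorphM ef.
  - by rewrite -rmorphD -pE psiK.
split=> u [v [uv vu]].
  have [||[e e'] [[f f'] [[eI _] [fI _] [ef _] [uE _]]]] := UAB (u, 1) (v, 1).
  - by congr (_, _); rewrite ?mulr1.
  - by congr (_, _); rewrite ?mulr1.
  - by exists e, f.
have [||[e' e] [[f' f] [[_ eI] [_ fI] [_ ef] [_ uE]]]] := UAB (1, u) (1, v).
- by congr (_, _); rewrite ?mulr1.
- by congr (_, _); rewrite ?mulr1.
- by exists e, f.
Qed.

(** A unit of the product has the form [(1, 1 + e) = 1 + (0, e)], and [(0, e)] is idempotent. *)
Lemma direct_sum_one_plus_idem :
  is_direct_sum R A B -> units A = [set 1] -> units B = one_plus_idem B ->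
  units R `<=` one_plus_idem R.
Proof.
move=> [phi [psi phiK psiK]] UA UB u [v [uv vu]].
have [uv' vu'] : phi u * phi v = 1 /\ phi v * phi u = 1.
  by rewrite -!rmorphM uv vu rmorph1.
have u1 : (phi u).1 = 1.
  have : units A (phi u).1.
    by exists (phi v).1; rewrite -[1]/(1 : A * B).1 -{1}uv' -vu'.
  by rewrite UA.
have : units B (phi u).2.
  by exists (phi v).2; rewrite -[1]/(1 : A * B).2 -{1}uv' -vu'.
rewrite UB => -[e eI u2]; exists (psi (0, e)).
  apply: (can_inj phiK); rewrite rmorphM !psiK.
  by congr (_, _); rewrite ?mulr0.
apply: (can_inj phiK); rewrite rmorphD rmorph1 psiK [RHS]surjective_pairing u1 -u2.
by congr (_, _); rewrite addr0.
Qed.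

End DirectSum.

(** * Characteristic of strong UII-rings, and their units when it divides 2 or 3 *)

Section StrongUII.

Context {R : pzRingType}.

Lemma strong_UII_of_units_sub :
  units R `<=` one_plus_idem R -> strong_UII R.
Proof.
move=> UR u /UR [e eI <-]; exists 1, e.
by split=> //; [exact: mulr1 | exact/commr_sym/commr1].
Qed.

(** Multiplying [-1 = e + f] by [e] and by [f] gives [e * f = -2e = -2f]. Once [3(e * f) = 0], both
    [6e] and [6f] vanish, hence so does [-6 = 6e + 6f]. *)
Lemma strong_UII_natr6 : strong_UII R -> 6%:R = 0 :> R.
Proof.
move=> UR; have [|e [f [eI fI ef N1E]]] := UR (- 1).
  by exists (- 1); rewrite mulrNN mulr1.
have e2 : e * f = - (e *+ 2).
  apply/eqP; rewrite -addr_eq0 mulr2n addrA addrC.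
  have : e * (- 1) = e * e + e * f by rewrite -mulrDr -N1E.
  by rewrite mulrN1 eI => eE; rewrite [e * f + e]addrC -eE addrN.
have f2 : e * f = - (f *+ 2).
  apply/eqP; rewrite -addr_eq0 mulr2n addrA.
  have : (- 1) * f = e * f + f * f by rewrite -mulrDl -N1E.
  by rewrite mulN1r fI => <-; rewrite addNr.
(* Multiply [e * f = -2e] by [f] on the right. *)
have ef3 : (e * f) *+ 3 = 0.
  have /eqP : e * f = - ((e * f) *+ 2).
    by rewrite -{1}fI mulrA {1}e2 mulNr mulrnAl.
  by rewrite -addr_eq0 -mulrS => /eqP.
have e6 : e *+ 6 = 0.
  by move/eqP: ef3; rewrite e2 mulNrn oppr_eq0 -mulrnA => /eqP.
have f6 : f *+ 6 = 0.
  by move/eqP: ef3; rewrite f2 mulNrn oppr_eq0 -mulrnA => /eqP.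
by apply/eqP; rewrite -oppr_eq0 -mulNrn N1E mulrnDl e6 f6 addr0.
Qed.

Lemma strong_UII_char2 : strong_UII R -> 2%:R = 0 :> R -> units R = [set 1].
Proof.
move=> UR two0; apply/seteqP; split=> [u Uu|_ ->]; last first.
  by exists 1; rewrite mulr1.
have [e [f [eI fI ef uE]]] := UR u Uu.
(* The cross term [2(e * f)] of the square vanishes. *)
have uu : u * u = u.
  rewrite uE mulrDl !mulrDr eI fI -ef addrA -[e + e * f + e * f]addrA.
  by rewrite -mulr2n -mulr_natr two0 mulr0 addr0.
by have [v [uv _]] := Uu; rewrite /= -uv -{2}uu -mulrA uv mulr1.
Qed.

Lemma strong_UII_char3 :
  strong_UII R -> 3%:R = 0 :> R -> units R = one_plus_idem R.
Proof.
move=> UR three0.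
have x3 (x : R) : x *+ 3 = 0 by rewrite -mulr_natr three0 mulr0.
have xN (x : R) : x *+ 2 = - x by apply/eqP; rewrite -addr_eq0 -mulrSr x3.
apply/seteqP; split=> [u Uu|_ [e eI <-]]; last first.
  (* The square is [1 + 3e], so [1 + e] is its own inverse. *)
  have ee : (1 + e) * (1 + e) = 1.
    rewrite mulrDl mul1r mulrDr mulr1 (eI : e * e = e) -addrA -mulr2n xN.
    by rewrite addrN addr0.
  by exists (1 + e).
have [e [f [eI fI ef uE]]] := UR u Uu.
(* The cross term [2(e * f)] is [-(e * f)]; multiplying by [u] once more cancels it, giving
   [u^3 = u]. *)
have uu : u * u = u - e * f.
  by rewrite uE mulrDl !mulrDr eI fI -ef -xN mulr2n [e * f + f]addrC addrACA.
have efu : u * (e * f) = - (e * f).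
  by rewrite uE mulrDl !mulrA eI -ef -mulrA fI -mulr2n xN.
have uuu : u * u * u = u.
  by rewrite -mulrA uu mulrBr uu efu opprK subrK.
have u2 : u * u = 1.
  by have [v [uv _]] := Uu; rewrite -[u * u]mulr1 -uv mulrA uuu.
exists (u - 1); last by rewrite addrC subrK.
(* The square is [2 - 2u], which equals [u - 1] because [2 = -1]. *)
by rewrite /idem /= mulrBr mulrBl u2 mul1r mulr1 opprB -mulr2n xN opprB.
Qed.

End StrongUII.

Lemma strong_UII_decomposition (R : pzRingType) : strong_UII R ->
  exists A B : pzRingType,
    [/\ is_direct_sum R A B, units A = [set 1] & units B = one_plus_idem B].
Proof.
move=> UR; have six0 := strong_UII_natr6 UR.
have cC (x : R) : GRing.comm 3%:R x by apply/commr_sym/commr_nat.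
(* [9 = 6 + 3 = 3]. *)
have cI : idem R 3%:R by rewrite /idem /= -natrM (natrD _ 6 3) six0 add0r.
have sum := direct_sum_corners 3%:R cC cI.
have [UA UB] := strong_UII_direct_sum sum UR.
exists (corner cC cI), (corner (commB1 _ cC) (idemB1 _ cI)); split=> //.
  (* The identity of this corner is [3], and [2 * 3 = 6 = 0]. *)
  by apply: strong_UII_char2 => //; apply: corner_natr_eq0; rewrite -mulrnA.
(* The identity is now [1 - 3], and [3 * (1 - 3) = 3 - 9 = 0]. *)
apply: strong_UII_char3 => //; apply: corner_natr_eq0.
by rewrite mulrnBl -mulrnA (natrD _ 6 3) six0 add0r subrr.
Qed.

Theorem theorem3p14 (R : pzRingType) :
  strong_UII R <->
  [\/ units R = [set 1],
      units R = one_plus_idem R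
    | exists A B : pzRingType,
        [/\ is_direct_sum R A B,
            units A = [set 1]
          & units B = one_plus_idem B]].
Proof.
split=> [/strong_UII_decomposition ?|UR]; first exact: Or33.
(* Each of the three types yields that every unit is [1] plus an idempotent; in the first type that
   idempotent is [0]. *)
apply: strong_UII_of_units_sub.
case: UR => [->|->//|[A [B [sum UA UB]]]].
  by move=> _ ->; exists 0; [exact: mulr0 | exact: addr0].
exact: direct_sum_one_plus_idem sum UA UB.
Qed.
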